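(* Let $p\in(0,1)$ be a constant and consider the random graph $G(n,p)$ with i.i.d. edge weights with $\Pr(w_{ij}=v_k)=p_k$, $k=1,\dots,K$. Then the average performance ratio $PR$ of Algorithm 1 (greedy matching), with expectations taken over both $G\sim G(n,p)$ and $W$, satisfies $$\lim_{n\to\infty}PR=1 .$$
   Context: $G(n,p)$ is the Erdős–Rényi random graph on $n$ users in which each pair of users is joined independently with probability $p$. Edge weights are i.i.d. (and independent of the graph), taking values in the finite set $\{v_1,\dots,v_K\}$, $0\le v_1<\cdots<v_K$, with $\Pr(w_{ij}=v_k)=p_k$, $\sum_k p_k=1$; $K$, the $v_k$ and the $p_k$ are fixed as $n\to\infty$. Algorithm 1 (greedy matching): initially all users are unmatched. Each iteration has two phases. Proposal phase: every unmatched user having at least one unmatched neighbor sends a proposal to the unmatched neighbor to which it is joined by the edge of largest weight; nodes are assigned unique numbers, and ties are broken in favor of the neighbor with the highest number. Matching phase: every pair of users that proposed to each other is matched and becomes unavailable to others. The algorithm stops when no unmatched user has an unmatched neighbor. $\hat f(G,W)$ is the total weight of the matching returned by Algorithm 1, $f^\star(G,W)$ is the maximum total weight of a matching of $(G,W)$, and for random graphs the average performance ratio is $PR=\mathbb{E}_{G,W}[\hat f(G,W)]/\mathbb{E}_{G,W}[f^\star(G,W)]$. *)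

(* Defs.v *)
From mathcomp Require Import all_boot all_order all_algebra.
From mathcomp Require Import reals.

Set Implicit Arguments.
Unset Strict Implicit.
Unset Printing Implicit Defensive.

Import Order.TTheory GRing.Theory Num.Theory.

Local Open Scope ring_scope.

(* Unordered pairs of distinct users; a graph on the users is a set of them. *)
Definition upair (n : nat) := {e : {set 'I_n} | #|e| == 2}.

Section Model.
Variables (R : realType) (n K : nat).

(* The weights are drawn for all pairs, joined or not: only those of the edges
   of the graph are ever used.  W e is the index of the value v (W e). *)
Definition graph := {set upair n}.
Definition weights := {ffun upair n -> 'I_K}.

Variable v : 'I_K -> R.

Implicit Types (G M : graph) (W : weights) (i j : 'I_n).

Definition users M : {set 'I_n} := \bigcup_(e in M) val e.

Definition matching G M : bool :=
  (M \subset G) && [forall e in M, forall f in M,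
                      (e != f) ==> [disjoint val e & val f]].

Definition total_weight W M : R := \sum_(e in M) v (W e).

(* The default 0 is the weight of the empty matching. *)
Definition max_matching_weight G W : R :=
  \big[Num.max/0]_(M : graph | matching G M) total_weight W M.

(* insub [set i; j] is None exactly when i = j. *)
Definition adjacent G i j : bool :=
  if insub [set i; j] is Some e then e \in G else false.

Definition weight W i j : R :=
  if insub [set i; j] is Some e then v (W e) else 0.

Section Greedy.
Variables (num : 'I_n -> nat) (G : graph) (W : weights).

Definition available M i j : bool :=
  [&& i \notin users M, j \notin users M & adjacent G i j].

Definition proposes M i j : bool :=
  available M i j &&
  [forall j' : 'I_n, available M i j' ==>
     ((weight W i j' < weight W i j) ||
      ((weight W i j' == weight W i j) && (num j' <= num j)%N))].

Definition greedy_step M : graph :=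
  M :|: [set e : upair n | [exists i : 'I_n, exists j : 'I_n,
           [&& val e == [set i; j], proposes M i j & proposes M j i]]].

Definition stopped M : bool :=
  [forall i : 'I_n, forall j : 'I_n, ~~ available M i j].

(* A step changes nothing once the algorithm has stopped, and n steps are
   enough to reach that point: see greedy_step_stopped, greedy_stopped. *)
Definition greedy : graph := iter n greedy_step set0.

Lemma greedy_step_stopped M : stopped M -> greedy_step M = M.
Proof.
move=> stM; apply/setP=> e; rewrite !inE; apply/orb_idr.
case/existsP=> i /existsP[j /and3P[_ /andP[av _] _]].
by move/forallP/(_ i)/forallP/(_ j): stM; rewrite av.
Qed.

Lemma adjacentC i j : adjacent G i j = adjacent G j i.
Proof. by rewrite /adjacent setUC. Qed.

Lemma weightC i j : weight W i j = weight W j i.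
Proof. by rewrite /weight setUC. Qed.

Lemma availableC M i j : available M i j = available M j i.
Proof. by rewrite /available adjacentC andbCA. Qed.

Lemma greedy_step_progress M :
  ~~ stopped M -> users M \proper users (greedy_step M).
Proof.
rewrite negb_forall => /existsP[i0]; rewrite negb_forall => /existsP[j0].
rewrite negbK => av0.
pose A (x : 'I_n * 'I_n) := available M x.1 x.2.
pose wt (x : 'I_n * 'I_n) := weight W x.1 x.2.
have A0 : A (i0, j0) by [].
case: (@Order.TotalTheory.arg_maxP _ _ _ (i0, j0) A wt A0) => -[a b] Aab maxw.
pose B i := [exists j, available M i j && (weight W i j == weight W a b)].
have Ba : B a by apply/existsP; exists b; rewrite eqxx andbT.
case: (arg_maxnP num Ba) => i /existsP[c /andP[avc /eqP wc]] maxi.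
pose C j := available M i j && (weight W i j == weight W a b).
have Cc : C c by rewrite /C avc wc eqxx.
case: (arg_maxnP num Cc) => j /andP[avj /eqP wj] maxj.
have pij : proposes M i j.
  rewrite /proposes avj; apply/forallP=> j'; apply/implyP=> av'.
  have := maxw (i, j') av'; rewrite /wt /= -wj le_eqVlt => /orP[/eqP w'|->//].
  rewrite w' eqxx; apply/orP; right; apply: maxj.
  by rewrite /C av' w' wj eqxx.
have pji : proposes M j i.
  rewrite /proposes availableC avj; apply/forallP=> i'; apply/implyP=> av'.
  have := maxw (j, i') av'; rewrite /wt /= -wj (weightC j i) le_eqVlt.
  case/orP=> [/eqP w'|->//]; rewrite w' eqxx; apply/orP; right; apply: maxi.
  by apply/existsP; exists j; rewrite availableC av' weightC w' wj eqxx.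
have /and3P[ui _ aij] := avj.
move: aij; rewrite /adjacent; case: insubP => // e _ ve _.
apply/properP; split.
  by apply/subsetP=> k /bigcupP[f fM kf]; apply/bigcupP; exists f; rewrite ?inE ?fM.
exists i => //; apply/bigcupP; exists e; last by rewrite ve !inE eqxx.
rewrite !inE; apply/orP; right; apply/existsP; exists i; apply/existsP; exists j.
by rewrite ve eqxx pij pji.
Qed.

Lemma greedy_stopped : stopped greedy.
Proof.
have H t : stopped (iter t greedy_step set0) \/
           (t <= #|users (iter t greedy_step set0)|)%N.
  elim: t => [|t [st|IH]]; first by right.
    by left; rewrite /= greedy_step_stopped.
  have [st|nst] := boolP (stopped (iter t greedy_step set0)).
    by left; rewrite /= greedy_step_stopped.
  by right; apply: (leq_ltn_trans IH); exact/proper_card/greedy_step_progress.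
have [//|le_n] := H n; apply/forallP=> i; apply/forallP=> j.
rewrite /available negb_and negbK; apply/orP; left.
suff -> : users (iter n greedy_step set0) = [set: 'I_n] by rewrite inE.
by apply/eqP; rewrite eqEcard subsetT cardsT card_ord.
Qed.

End Greedy.

Definition greedy_weight (num : 'I_n -> nat) G W : R :=
  total_weight W (greedy num G W).

Variables (p : R) (q : 'I_K -> R).

Definition graph_prob G : R := p ^+ #|G| * (1 - p) ^+ #|~: G|.

Definition weights_prob W : R := \prod_(e : upair n) q (W e).

(* The expectation for the product law: G and W are independent. *)
Definition expectation (X : graph -> weights -> R) : R :=
  \sum_(G : graph) \sum_(W : weights) graph_prob G * weights_prob W * X G W.

Definition performance_ratio (num : 'I_n -> nat) : R :=
  expectation (greedy_weight num) / expectation max_matching_weight.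

End Model.

(* Main.v *)
(** Let w be the largest weight of positive probability and r > 0 the probability
    that two users are joined by an edge of weight w.  Every edge meets an edge of
    the greedy matching that is at least as heavy, so the users left uncovered by
    the greedy edges of weight w span no edge of weight w.  By a union bound, some
    set of more than n/m users spans no such edge with probability at most
    2^n (1-r)^binom(n/m+1,2), which vanishes.  The greedy weight is thus at least
    w (n - n/m) / 2 with high probability, while no matching exceeds w n / 2. *)

Require Import Defs.
From mathcomp Require Import all_boot all_order all_algebra.
From mathcomp Require Import reals ring lra.
Set Implicit Arguments.
Unset Strict Implicit.
Unset Printing Implicit Defensive.

Import Order.TTheory GRing.Theory Num.Theory.
Local Open Scope ring_scope.

(** * Matchings on a fixed weighted graph *)

Section Matchings.
Context {R : realType} {n K : nat} (v : 'I_K -> R).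
Implicit Types (G M : graph n) (W : weights n K) (e f : upair n) (i j : 'I_n).

Lemma mem_users M i : reflect (exists2 e, e \in M & i \in val e) (i \in users M).
Proof. exact: bigcupP. Qed.

Lemma upair_mate e i :
  i \in val e -> exists2 j, i != j & val e = [set i; j].
Proof.
have /cards2P[a [b [ab ->]]] := valP e.
rewrite !inE => /orP[]/eqP->; first by exists b.
by exists a; rewrite 1?eq_sym // setUC.
Qed.

Lemma upair_disjoint e f i : i \in val e -> i \in val f -> ~~ [disjoint val e & val f].
Proof. by move=> ie jf; apply/pred0Pn; exists i; rewrite /= ie. Qed.

Lemma upair_meetP e f :
  reflect (exists2 i, i \in val e & i \in val f) (~~ [disjoint val e & val f]).
Proof.
by apply: (iffP pred0Pn) => [[i /andP[]]|[i ie jf]]; exists i => //; rewrite /= ie.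
Qed.

Lemma adjacentE G e i j : val e = [set i; j] -> adjacent G i j = (e \in G).
Proof. by rewrite /adjacent => <-; rewrite valK. Qed.

Lemma weightE W e i j : val e = [set i; j] -> weight v W i j = v (W e).
Proof. by rewrite /weight => <-; rewrite valK. Qed.

Lemma card_users_le M : (#|users M| <= 2 * #|M|)%N.
Proof.
rewrite mulnC -sum_nat_const /users.
elim/big_ind2: _ => [|A a B b Aa Bb|e _]; first by rewrite cards0.
- by rewrite cardsU (leq_trans (leq_subr _ _)) // leq_add.
- by rewrite (eqP (valP e)).
Qed.

Lemma matching_sub G M : matching G M -> M \subset G.
Proof. by case/andP. Qed.

Lemma matching_eq G M e f i : matching G M ->
  e \in M -> f \in M -> i \in val e -> i \in val f -> e = f.
Proof.
case/andP=> _ /forall_inP mM eM fM ie jf; apply/eqP/contraT => ef.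
have /forall_inP/(_ f fM) := mM e eM.
by rewrite ef /= (negbTE (upair_disjoint ie jf)).
Qed.

(** Incidences between users and edges of [M] are counted twice: each edge has two users, and each
    user lies on at most one edge. *)
Lemma matching_card G M : matching G M -> (2 * #|M| <= n)%N.
Proof.
move=> mM; rewrite mulnC -sum_nat_const.
have -> : (\sum_(e in M) 2 = \sum_(i < n) \sum_(e in M | i \in val e) 1)%N.
  rewrite (exchange_big_dep (mem M)) //=; last by move=> i e _ /andP[].
  apply: eq_bigr => e eM; transitivity #|val e|; first by rewrite (eqP (valP e)).
  by rewrite -sum1_card; apply: eq_bigl => i; rewrite eM.
rewrite -[leqRHS]card_ord -[leqRHS]sum1_card leq_sum // => i _.
rewrite sum1_card; apply/card_le1_eqP => e f.
rewrite !unfold_in => /andP[eM ie] /andP[fM jf].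
exact: matching_eq mM fM eM jf ie.
Qed.

Lemma matching_weight_le G W M (w : R) : 0 <= w -> (forall e, v (W e) <= w) ->
  matching G M -> total_weight v W M <= w * n%:R / 2.
Proof.
move=> w0 vw mM; apply: (@le_trans _ _ (\sum_(e in M) w)); first exact: ler_sum.
rewrite sumr_const ler_pdivlMr // -[w *+ _]mulr_natr -mulrA ler_wpM2l //.
rewrite -natrM ler_nat mulnC.
exact: matching_card mM.
Qed.

(** * The greedy matching *)

Section Greedy.
Variables (num : 'I_n -> nat) (G : graph n) (W : weights n K).

Lemma proposesP M i j : proposes v num G W M i j ->
  available G M i j /\
  forall j', available G M i j' -> weight v W i j' < weight v W i j \/
    weight v W i j' = weight v W i j /\ (num j' <= num j)%N.
Proof.
case/andP=> av /forallP H; split=> // j' av'.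
by have /implyP/(_ av')/orP[|/andP[/eqP]] := H j'; [left|right].
Qed.

Lemma greedy_stepP M e : e \in greedy_step v num G W M -> e \in M \/
  forall i, i \in val e -> exists2 j, val e = [set i; j] & proposes v num G W M i j.
Proof.
rewrite !inE => /orP[|/existsP[i /existsP[j /and3P[/eqP eij pij pji]]]]; first by left.
right=> k; rewrite eij !inE => /orP[]/eqP->; first by exists j.
by exists i; rewrite // setUC.
Qed.

Hypothesis num_inj : injective num.

(** Two best neighbours have equal weight, so each number bounds the other; distinct numbers then
    make the proposal of a user unique. *)
Lemma proposes_inj M i j k :
  proposes v num G W M i j -> proposes v num G W M i k -> j = k.
Proof.
move=> /proposesP[avj Hj] /proposesP[avk Hk]; apply/num_inj/eqP; rewrite eqn_leq.
case: (Hj k avk) (Hk j avj) => [lt|[eq_w ->]] [lt'|[eq_w' ->]] //.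
- by have := lt_trans lt lt'; rewrite ltxx.
- by move: lt; rewrite eq_w' ltxx.
- by move: lt'; rewrite eq_w ltxx.
Qed.

(** Let two edges share the user [i]. If both are old, [M] is a matching; one old and one new is
    impossible, since only unmatched users propose; if both are new, each is the unique proposal of
    [i]. *)
Lemma greedy_step_matching M : matching G M -> matching G (greedy_step v num G W M).
Proof.
move=> mM; apply/andP; split.
  apply/subsetP=> e /greedy_stepP[/(subsetP (matching_sub mM))//|new].
  have /card_gt0P[i /new[j eij /proposesP[/and3P[_ _]]]] : (0 < #|val e|)%N.
    by rewrite (eqP (valP e)).
  by rewrite (adjacentE _ eij).
apply/forall_inP=> e eM; apply/forall_inP=> f fM; apply/implyP; apply: contraR.
case/upair_meetP => i ie jf.
have old_new (g h : upair n) : g \in M -> i \in val g ->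
    ~ exists2 j, val h = [set i; j] & proposes v num G W M i j.
  move=> gM ig [j _ /proposesP[/and3P[/mem_users[]]]]; by exists g.
case: (greedy_stepP eM) (greedy_stepP fM) => [eM'|/(_ i ie) ne] [fM'|/(_ i jf) nf].
- by rewrite (matching_eq mM eM' fM' ie jf).
- by case: (old_new e f).
- by case: (old_new f e).
- case: ne nf => [j ej pj] [k fk pk]; apply/eqP/val_inj.
  by rewrite ej fk (proposes_inj pj pk).
Qed.

Lemma greedy_matching : matching G (greedy v num G W).
Proof.
suff H t : matching G (iter t (greedy_step v num G W) set0) by exact: H.
elim: t => [|t IH]; last exact: greedy_step_matching.
by rewrite /matching sub0set; apply/forall_inP=> e; rewrite inE.
Qed.

End Greedy.

(* An edge first leaves the set of available edges when one of its ends i is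
   matched along an edge that i preferred to it. *)
Lemma greedy_dominates (num : 'I_n -> nat) G W e : e \in G ->
  exists2 f, f \in greedy v num G W &
    v (W e) <= v (W f) /\ ~~ [disjoint val e & val f].
Proof.
move=> eG; pose dom M := exists2 f, f \in M &
    v (W e) <= v (W f) /\ ~~ [disjoint val e & val f].
have inv t : dom (iter t (greedy_step v num G W) set0) \/
    forall i, i \in val e -> i \notin users (iter t (greedy_step v num G W) set0).
  elim: t => [|t [[f fM Hf]|IH]].
  - by right=> i _; apply/mem_users => -[f]; rewrite inE.
  - by left; exists f => //; rewrite inE fM.
  set M := iter t _ _ in IH *.
  have [/existsP[i /andP[ie /mem_users[f fM jf]]]|] :=
    boolP [exists i, (i \in val e) && (i \in users (greedy_step v num G W M))].
    case: (greedy_stepP fM) => [fM'|/(_ i jf)[k fk /proposesP[_ H]]].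
      by have /mem_users[] := IH i ie; exists f.
    have [j ij ej] := upair_mate ie.
    left; exists f => //; split; last exact: upair_disjoint ie jf.
    have /H : available G M i j.
      by rewrite /available (adjacentE _ ej) eG !IH // ej !inE eqxx orbT.
    by rewrite (weightE _ ej) (weightE _ fk) => -[/ltW//|[->]].
  by rewrite negb_exists => /forallP H; right => i ie; have := H i; rewrite ie.
(* After [n] rounds the algorithm has stopped, so an edge of [G] cannot have both ends unmatched. *)
case: (inv n) => // H.
have /card_gt0P[i ie] : (0 < #|val e|)%N by rewrite (eqP (valP e)).
have [j ij ej] := upair_mate ie.
have /forallP/(_ i)/forallP/(_ j) := greedy_stopped v num G W.
by rewrite /available (adjacentE _ ej) eG !H // ej !inE eqxx orbT.
Qed.

End Matchings.

(** * Expectations over the random graph and weights *)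

Section Expectation.
Context {R : realType} {n K : nat} (p : R) (q : 'I_K -> R).
Implicit Types (G : graph n) (W : weights n K) (A : {set upair n}) (t : 'I_K).
Implicit Types X Y : graph n -> weights n K -> R.

Lemma expectationB X Y : expectation p q (fun G W => X G W - Y G W) =
  expectation p q X - expectation p q Y.
Proof.
rewrite -sumrB; apply: eq_bigr => G _; rewrite -sumrB.
by apply: eq_bigr => W _; rewrite mulrBr.
Qed.

Lemma expectationZ (c : R) X :
  expectation p q (fun G W => c * X G W) = c * expectation p q X.
Proof.
rewrite mulr_sumr; apply: eq_bigr => G _; rewrite mulr_sumr.
by apply: eq_bigr => W _; rewrite mulrCA.
Qed.

Lemma expectation_sum (I : finType) (P : pred I) (X : I -> graph n -> weights n K -> R) :
  expectation p q (fun G W => \sum_(i | P i) X i G W) =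
  \sum_(i | P i) expectation p q (X i).
Proof.
rewrite exchange_big; apply: eq_bigr => G _; rewrite exchange_big.
by apply: eq_bigr => W _; rewrite mulr_sumr.
Qed.

(** In this form, one factor per pair, sums over graphs factor by distributivity. *)
Lemma graph_probE G : graph_prob p G = \prod_e (if e \in G then p else 1 - p).
Proof.
rewrite (bigID (mem G)) /= /graph_prob -!prodr_const; congr (_ * _).
  by apply: eq_bigr => e ->.
by rewrite big_mkcond [RHS]big_mkcond; apply: eq_bigr => e _; rewrite inE; case: (e \in G).
Qed.

(** Assignments using a weight of probability zero contribute nothing, so the comparison may assume
    that every drawn weight is at most the largest weight of positive probability. *)
Lemma le_expectation X Y : 0 <= p <= 1 -> (forall k, 0 <= q k) ->
  (forall G W, (forall e, 0 < q (W e)) -> X G W <= Y G W) ->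
  expectation p q X <= expectation p q Y.
Proof.
case/andP=> p0 p1 q0 XY; apply: ler_sum => G _; apply: ler_sum => W _.
have [/forallP qW|] := boolP [forall e, 0 < q (W e)].
  rewrite ler_wpM2l ?XY // mulr_ge0 //; last exact: prodr_ge0.
  by rewrite mulr_ge0 // exprn_ge0 // subr_ge0.
rewrite negb_forall => /existsP[e]; rewrite lt_def q0 andbT negbK => /eqP qe.
by rewrite /weights_prob (bigD1 e) //= qe mul0r mulr0 !mul0r.
Qed.

(** The indicator is a product of one factor [c] per pair, so independence makes the expectation a
    product: a pair in [A] contributes [1 - p * q t], any other pair 1. *)
Lemma prob_no_edge A t : \sum_k q k = 1 ->
  expectation p q
    (fun G W => [forall e in A, ~~ ((e \in G) && (W e == t))]%:R) =
  (1 - p * q t) ^+ #|A|.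
Proof.
move=> q1; pose c G e k : R := (if [&& e \in A, e \in G & k == t] then 0 else 1).
have cE G W :
    [forall e in A, ~~ ((e \in G) && (W e == t))]%:R = \prod_e c G e (W e).
  case: forall_inP => [noA|someA].
    by rewrite big1 // => e _; rewrite /c; case: ifP => // /andP[/noA/negP].
  have [e /andP[eA H]|noA] := pickP (fun e => [&& e \in A, e \in G & W e == t]).
    by rewrite (bigD1 e) //= /c eA H mul0r.
  by case: someA => e eA; have := noA e; rewrite eA => /negbT.
(* The weights are summed out first, for fixed [G]; the sum over graphs is distributed
   afterwards. *)
transitivity (\sum_(G : graph n) \prod_e
    (if e \in G then p * (1 - (e \in A)%:R * q t) else 1 - p)).
  apply: eq_bigr => G _.
  transitivity (graph_prob p G * \prod_e \sum_k q k * c G e k).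
    rewrite bigA_distr_bigA mulr_sumr; apply: eq_bigr => W _.
    by rewrite cE -mulrA /weights_prob -big_split.
  rewrite graph_probE -big_split; apply: eq_bigr => e _ /=.
  have [eG|eG] := boolP (e \in G); last first.
    rewrite (eq_bigr q) ?q1 ?mulr1 // => k _.
    by rewrite /c (negbTE eG) andbF mulr1.
  congr (_ * _); have [eA|eA] := boolP (e \in A); last first.
    rewrite mul0r subr0 -q1; apply: eq_bigr => k _.
    by rewrite /c (negbTE eA) mulr1.
  rewrite mul1r -q1 (bigD1 t) //= [in RHS](bigD1 t) //= addrAC subrr add0r.
  rewrite /c eA eG eqxx mulr0 add0r; apply: eq_bigr => k /negbTE->.
  by rewrite mulr1.
rewrite -bigA_distr -prodr_const [RHS]big_mkcond; apply: eq_bigr => e _.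
by case: (e \in A) => /=; ring.
Qed.

Lemma expectation_cst (c : R) : \sum_k q k = 1 ->
  expectation p q (fun (_ : graph n) _ => c) = c.
Proof.
move=> q1; transitivity (c * (\sum_(G : graph n) graph_prob p G) *
    \sum_(W : weights n K) weights_prob q W).
  rewrite -mulrA big_distrlr /= mulr_sumr; apply: eq_bigr => G _.
  by rewrite mulr_sumr; apply: eq_bigr => W _; rewrite mulrC.
rewrite (eq_bigr _ (fun G _ => graph_probE G)) -bigA_distr.
rewrite -(bigA_distr_bigA (fun _ : upair n => q)).
rewrite [X in c * X]big1 => [|e _]; last exact: subrKC.
by rewrite mulr1 big1 ?mulr1.
Qed.

End Expectation.

(** * Independent sets and the lower bound on the greedy weight *)

Definition pairs_in (n : nat) (S : {set 'I_n}) : {set upair n} :=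
  [set e : upair n | val e \subset S].

Lemma card_pairs_in n (S : {set 'I_n}) : #|pairs_in S| = 'C(#|S|, 2).
Proof.
rewrite -cards_draws -(card_imset _ val_inj); apply: eq_card => B.
rewrite inE; apply/imsetP/andP => [[e eS ->]|[BS B2]].
  by move: eS; rewrite inE (valP e).
by exists (Sub B B2); rewrite ?inE.
Qed.

Section LowerBound.
Context {R : realType} {n K : nat} (v : 'I_K -> R).
Implicit Types (G M : graph n) (W : weights n K) (S : {set 'I_n}) (t : 'I_K).

(** Independence in the subgraph of the edges of weight index [t], where a pair is joined with
    probability [p * q t]. *)
Definition independent t G W S : bool :=
  [forall e in pairs_in S, ~~ ((e \in G) && (W e == t))].

Lemma greedy_weight_ge (num : 'I_n -> nat) G W t (s : nat) :
  (forall k, 0 <= v k) -> (forall e, v (W e) <= v t) ->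
  (forall S, (s < #|S|)%N -> ~~ independent t G W S) ->
  v t * (n%:R - s%:R) / 2 <= greedy_weight v num G W.
Proof.
move=> v0 vt noS; pose T := [set e in greedy v num G W | v (W e) == v t].
have : independent t G W (~: users T).
  apply/forall_inP => e; rewrite inE => /subsetP eU; apply/negP => /andP[eG /eqP et].
  (* The greedy edge [f] is at least as heavy as [e], hence of the maximal weight [v t]; it lies in
     [T] and covers an end of [e]. *)
  have [f fM [wf /upair_meetP[i ie jf]]] := greedy_dominates v num W eG.
  have := eU i ie; rewrite inE => /mem_users[]; exists f => //.
  by rewrite inE fM eq_le vt -et.
move=> indT; have {noS} : (#|~: users T| <= s)%N.
  by rewrite leqNgt; apply: contraL indT; exact: noS.
rewrite cardsCs setCK card_ord leq_subLR => nT.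
have {nT} : (n <= 2 * #|T| + s)%N.
  by rewrite (leq_trans nT) // leq_add2r card_users_le.
rewrite -(ler_nat R) natrD natrM -lerBlDr => nT.
apply: (@le_trans _ _ (v t * #|T|%:R)).
  by rewrite -mulrA ler_wpM2l // ler_pdivrMr // mulrC.
rewrite mulr_natr -sumr_const /greedy_weight /total_weight.
rewrite [leRHS](bigID (fun e => v (W e) == v t)) /=.
apply: ler_wpDr; first exact: sumr_ge0.
rewrite le_eqVlt; apply/orP; left; apply/eqP.
by apply: eq_big => [e|e]; rewrite inE // => /andP[_ /eqP].
Qed.

(** If a large independent set exists, the sum is at least 1 and the left side is not positive;
    otherwise the sum vanishes. Being linear in the indicators, this bound passes to expectations
    term by term. *)
Lemma greedy_weight_ge_sum (num : 'I_n -> nat) G W t (s : nat) : (s <= n)%N ->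
  (forall k, 0 <= v k) -> (forall e, v (W e) <= v t) ->
  v t * (n%:R - s%:R) / 2 *
    (1 - \sum_(S : {set 'I_n} | (s < #|S|)%N) (independent t G W S)%:R)
  <= greedy_weight v num G W.
Proof.
move=> sn v0 vt; have c0 : 0 <= v t * (n%:R - s%:R) / 2.
  by rewrite divr_ge0 // mulr_ge0 // subr_ge0 ler_nat.
have [/existsP[S /andP[sS iS]]|] :=
  boolP [exists S : {set 'I_n}, (s < #|S|)%N && independent t G W S].
  apply: (@le_trans _ _ 0); last exact: sumr_ge0.
  rewrite mulr_ge0_le0 // subr_le0 (bigD1 S) //= iS lerDl.
  by apply: sumr_ge0 => ? _; rewrite ler0n.
rewrite negb_exists => /forallP noS.
rewrite big1 ?subr0 ?mulr1 => [|S sS].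
  by apply: greedy_weight_ge => // S sS; have := noS S; rewrite sS.
by have := noS S; rewrite sS /= => /negbTE->.
Qed.

(** Union bound: a set of more than [s] users spans at least ['C(s.+1, 2)] pairs, and there are at
    most [2 ^+ n] such sets. *)
Lemma expectation_greedy_ge (num : 'I_n -> nat) (p : R) (q : 'I_K -> R) t (s : nat) :
  0 <= p <= 1 -> (forall k, 0 <= q k) -> \sum_k q k = 1 ->
  (forall k, 0 <= v k) -> (forall k, 0 < q k -> v k <= v t) -> (s <= n)%N ->
  v t * (n%:R - s%:R) / 2 * (1 - 2 ^+ n * (1 - p * q t) ^+ 'C(s.+1, 2))
  <= expectation p q (greedy_weight v num).
Proof.
move=> p01 q0 q1 v0 vt sn; have /andP[p0 p1] := p01.
have c0 : 0 <= v t * (n%:R - s%:R) / 2.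
  by rewrite divr_ge0 // mulr_ge0 // subr_ge0 ler_nat.
have qt1 : q t <= 1 by rewrite -q1 (bigD1 t) //= lerDl sumr_ge0.
have x0 : 0 <= 1 - p * q t by rewrite subr_ge0 mulr_ile1.
have x1 : 1 - p * q t <= 1 by rewrite gerBl mulr_ge0.
apply: (@le_trans _ _ (expectation p q (fun G W => v t * (n%:R - s%:R) / 2 *
    (1 - \sum_(S : {set 'I_n} | (s < #|S|)%N) (independent t G W S)%:R)))); last first.
  by apply: le_expectation => // G W qW; apply: greedy_weight_ge_sum => // e; exact: vt.
rewrite expectationZ ler_wpM2l // expectationB expectation_cst // expectation_sum.
rewrite lerD2l lerN2; apply: (@le_trans _ _
  (\sum_(S : {set 'I_n}) (1 - p * q t) ^+ 'C(s.+1, 2))).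
  rewrite big_mkcond; apply: ler_sum => S _; case: ifP => [sS|_]; last exact: exprn_ge0.
  by rewrite prob_no_edge // card_pairs_in ler_wiXn2l // leq_bin2l.
rewrite sumr_const -cardsT -powersetT card_powerset cardsT card_ord.
by rewrite -[_ *+ _]mulr_natl natrX.
Qed.

End LowerBound.

(** * Comparison with the maximum weight matching *)

Lemma expectation_max_le (R : realType) (n K : nat) (v q : 'I_K -> R) (p : R) t :
  0 <= p <= 1 -> (forall k, 0 <= q k) -> \sum_k q k = 1 -> 0 <= v t ->
  (forall k, 0 < q k -> v k <= v t) ->
  expectation p q (max_matching_weight (n := n) v) <= v t * n%:R / 2.
Proof.
move=> p01 q0 q1 v0 vt; rewrite -[leRHS](expectation_cst (n := n) p _ q1).
apply: le_expectation => // G W qW; apply: bigmax_le => [|M].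
  (* The default 0 of the maximum must obey the bound too. *)
  by rewrite divr_ge0 // mulr_ge0.
by apply: matching_weight_le => // e; exact: vt.
Qed.

Lemma expectation_greedy_le_max (R : realType) (n K : nat) (v q : 'I_K -> R) (p : R)
    (num : 'I_n -> nat) : 0 <= p <= 1 -> (forall k, 0 <= q k) -> injective num ->
  expectation p q (greedy_weight v num) <= expectation p q (max_matching_weight (n := n) v).
Proof.
move=> p01 q0 num_inj; apply: le_expectation => // G W _.
have mM := greedy_matching v G W num_inj.
exact: (le_bigmax_cond _ (total_weight v W) mM).
Qed.

(* Asymptotics and the limit of the ratio *)
From mathcomp Require Import all_classical all_analysis.
Import numFieldNormedType.Exports.
Local Open Scope classical_set_scope.

(** With [s = n %/ m], the hypothesis gives [s >= 2 * L * m], while [s.+1 * m > n]; hence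
    [s.+1 * s >= 2 * L * n]. *)
Lemma bin2_superlinear (L m n : nat) : (0 < m)%N -> (2 * L * m * m <= n)%N ->
  (L * n <= 'C((n %/ m).+1, 2))%N.
Proof.
move=> m0; rewrite -leq_divRL // => Ls; rewrite bin2 -(doubleK (L * n)%N) half_leq //=.
rewrite (@leq_trans ((n %/ m).+1 * (2 * L * m))%N)  //; last by rewrite leq_mul.
rewrite -mul2n mulnA [leqRHS]mulnCA leq_mul2l.
by rewrite (ltnW (ltn_ceil n m0)) orbT.
Qed.

(** Once [x ^+ L] is at most 1/4, an exponent of at least [L * n] bounds the product by
    [2 ^ n / 4 ^ n], which is below [1 / n]. *)
Lemma exp_bin2_small (R : realType) (x : R) (m : nat) : 0 <= x < 1 -> (0 < m)%N ->
  \forall n \near \oo, 2 ^+ n * x ^+ 'C((n %/ m).+1, 2) <= m%:R^-1.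
Proof.
case/andP=> x0 x1 m0.
have [L xL] : exists L, x ^+ L <= 2^-1 ^+ 2.
  have /cvgrPdist_le/(_ (2^-1 ^+ 2)) : x ^+ n @[n --> \oo] --> (0 : R).
    by apply: cvg_expr; rewrite ger0_norm.
  case=> [|L _ /(_ L (leqnn L))]; first by rewrite exprn_gt0.
  by rewrite sub0r normrN ger0_norm ?exprn_ge0 //; exists L.
near=> n.
have n1 : (2 * L * m * m <= n)%N by near: n; exact: nbhs_infty_ge.
have mn : (m <= n)%N by near: n; exact: nbhs_infty_ge.
apply: (@le_trans _ _ (2 ^+ n * 2^-1 ^+ 2 ^+ n)).
  rewrite ler_wpM2l ?exprn_ge0 // (le_trans (ler_wiXn2l x0 (ltW x1) (bin2_superlinear m0 n1))) //.
  by rewrite exprM lerXn2r // nnegrE exprn_ge0.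
rewrite -exprMn expr2 mulrA divff ?pnatr_eq0 // mul1r exprVn lef_pV2 ?posrE ?ltr0n ?exprn_gt0 //.
by rewrite -natrX ler_nat (leq_trans mn) // ltnW // ltn_expl.
Unshelve. all: by end_near. Qed.

Theorem proposition9 (R : realType) (K : nat) (v q : 'I_K -> R) (p : R)
    (num : forall n : nat, 'I_n -> nat)
    (v_ge0 : forall k : 'I_K, 0 <= v k)
    (v_incr : forall k l : 'I_K, (k < l)%N -> v k < v l)
    (q_ge0 : forall k : 'I_K, 0 <= q k)
    (q_sum1 : \sum_(k < K) q k = 1)
    (weights_not_null : exists k : 'I_K, 0 < v k /\ 0 < q k)
    (p_gt0 : 0 < p) (p_lt1 : p < 1)
    (num_inj : forall n : nat, injective (num n)) :
  performance_ratio v p q (num n) @[n --> \oo] --> (1 : R).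
Proof.
(* [v t] is the largest weight of positive probability, and it is positive because some positive
   weight has positive probability. *)
have [t [vt0 qt0 vt]] : exists t : 'I_K,
    [/\ 0 < v t, 0 < q t & forall k, 0 < q k -> v k <= v t].
  have [k [vk qk]] := weights_not_null.
  case: (@arg_maxP _ _ _ k (fun l => 0 < q l) v qk) => t qt vt.
  by exists t; split => //; exact: lt_le_trans vk (vt k qk).
have p01 : 0 <= p <= 1 by rewrite !ltW.
have qt1 : q t <= 1 by rewrite -q_sum1 (bigD1 t) //= lerDl sumr_ge0.
have x01 : 0 <= 1 - p * q t < 1.
  by apply/andP; rewrite subr_ge0 gtrBl mulr_gt0 // mulr_ile1 // ltW.
apply/cvgrPdist_le => /= eps eps0.
(* The ratio will be at least [(1 - b) ^+ 2], hence at least [1 - 2 * b], so [m] has to exceed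
   [2 / eps]. The shift by 2 also gives [m > 1], that is [b < 1]. *)
pose m := (Num.bound (2 / eps)).+2; pose b : R := m%:R^-1.
have b_eps : 2 * b <= eps.
  rewrite ler_pdivrMr ?ltr0n // mulrC -ler_pdivrMr // ltW //.
  rewrite (lt_le_trans (archi_boundP _)) ?divr_ge0 ?(ltW eps0) //.
  by rewrite ler_nat (leq_trans (leqnSn _)) /m.
have b0 : 0 < b by rewrite invr_gt0 ltr0n.
have b1 : b < 1 by rewrite invf_lt1 ?ltr0n // ltr1n.
near=> n.
have n0 : (0 < n)%N by near: n; exact: nbhs_infty_ge.
have small : 2 ^+ n * (1 - p * q t) ^+ 'C((n %/ m).+1, 2) <= b.
  by near: n; exact: exp_bin2_small.
rewrite /performance_ratio; set g := Defs.expectation _ _ _; set f := Defs.expectation _ _ _.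
have gf : g <= f by exact: expectation_greedy_le_max.
have fa : f <= v t * n%:R / 2 by exact: expectation_max_le.
(* One factor [1 - b] accounts for the at most [n %/ m] users left uncovered, the other for the
   exceptional event. *)
have ga : (1 - b) ^+ 2 * (v t * n%:R / 2) <= g.
  apply: le_trans (expectation_greedy_ge (num n) p01 q_ge0 q_sum1 v_ge0 vt (leq_div n m)).
  have -> : (1 - b) ^+ 2 * (v t * n%:R / 2) = v t * (n%:R - n%:R * b) / 2 * (1 - b) by ring.
  apply: ler_pM; rewrite ?subr_ge0 ?(ltW b1) //; last by rewrite lerD2l lerN2.
    by rewrite divr_ge0 // mulr_ge0 // subr_ge0 ler_piMr // ltW.
  rewrite ler_wpM2r ?invr_ge0 // ler_wpM2l // lerD2l lerN2.
  by rewrite ler_pdivlMr ?ltr0n // -natrM ler_nat leq_trunc_div.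
(* Positivity of [g] passes to [f], so the bounds can be divided by [f]. *)
have g0 : 0 < g.
  by rewrite (lt_le_trans _ ga) // mulr_gt0 ?exprn_gt0 ?subr_gt0 // divr_gt0 ?mulr_gt0 ?ltr0n.
have f0 : 0 < f by exact: lt_le_trans gf.
rewrite ger0_norm ?subr_ge0 ?ler_pdivrMr ?mul1r //.
have : (1 - b) ^+ 2 <= g / f.
  by rewrite ler_pdivlMr // (le_trans _ ga) // ler_wpM2l ?sqr_ge0.
have := sqr_ge0 b; nra.
Unshelve. all: by end_near. Qed.
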